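(* Let $\mathcal{A}$ be an additive $k$-category and let $f:X\to Y$ be a morphism in $\mathbf{C}^b(\mathcal{A})$. Let $\ell(X\oplus Y)$ be the size of the direct sum of the complexes $X$ and $Y$. For every integer $m\ge\ell(X\oplus Y)$, $\mathcal{F}_m(f)$ is irreducible in $\mathbf{C}_{\equiv m}(\mathcal{A})$ if and only if $f$ is irreducible in $\mathbf{C}^b(\mathcal{A})$.
   Context: $k$ is a commutative ring. $\mathbf{C}^b(\mathcal{A})$ is the category of bounded cochain complexes over $\mathcal{A}$; $\mathbf{C}_{[1,n]}(\mathcal{A})$ is the full subcategory of complexes with $X^i=0$ for $i\notin[1,n]$. The size $\ell(W)$ of a bounded complex $W$ is the smallest positive integer $n$ such that some shift $W[t]$ lies in $\mathbf{C}_{[1,n]}(\mathcal{A})$. For a positive integer $m$, $\mathbf{C}_{\equiv m}(\mathcal{A})$ is the category of $m$-periodic complexes: complexes $X=(X^i,d_X^i)_{i\in\mathbb{Z}}$ with $X^i=X^j$ and $d_X^i=d_X^j$ whenever $i\equiv j\pmod m$; morphisms are chain maps $(f^i)$ with $f^i=f^j$ whenever $i\equiv j\pmod m$. The compression functor $\mathcal{F}_m:\mathbf{C}^b(\mathcal{A})\to\mathbf{C}_{\equiv m}(\mathcal{A})$ is given by $\mathcal{F}_m(X)^i=\bigoplus_{t\in\mathbb{Z}}X^{i+tm}$ with diagonal differential with components $d_X^{i+tm}$, and $\mathcal{F}_m(f)^i$ is diagonal with components $f^{i+tm}$. A morphism $f:X\to Y$ in an additive category is a section (resp. retraction) if there is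 $h:Y\to X$ with $hf=1_X$ (resp. $fh=1_Y$). It is irreducible if it is neither a section nor a retraction and, whenever $f=hg$, either $g$ is a section or $h$ is a retraction. *)

(* Defs.v *)
From HB Require Import structures.
From mathcomp Require Import all_boot all_order all_algebra.
From mathcomp Require Import boolp.
From mathcomp Require Import zify.

Set Implicit Arguments.
Unset Strict Implicit.
Unset Printing Implicit Defensive.

Import GRing.Theory.
Local Open Scope ring_scope.

Record category := Category {
  cat_ob :> Type;
  cat_hom : cat_ob -> cat_ob -> Type;
  cat_id : forall A, cat_hom A A;
  cat_comp : forall A B C, cat_hom B C -> cat_hom A B -> cat_hom A C;
  cat_idl : forall A B (f : cat_hom A B), cat_comp (cat_id B) f = f;
  cat_idr : forall A B (f : cat_hom A B), cat_comp f (cat_id A) = f;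
  cat_assoc : forall A B C D (h : cat_hom C D) (g : cat_hom B C)
    (f : cat_hom A B), cat_comp h (cat_comp g f) = cat_comp (cat_comp h g) f }.

Arguments cat_hom {c}.
Arguments cat_id {c}.
Arguments cat_comp {c A B C}.

Section Irreducible.
Variable C : category.

Definition section (X Y : C) (f : cat_hom X Y) : Prop :=
  exists h : cat_hom Y X, cat_comp h f = cat_id X.

Definition retraction (X Y : C) (f : cat_hom X Y) : Prop :=
  exists h : cat_hom Y X, cat_comp f h = cat_id Y.

Definition irreducible (X Y : C) (f : cat_hom X Y) : Prop :=
  [/\ ~ section f, ~ retraction f &
      forall (Z : C) (g : cat_hom X Z) (h : cat_hom Z Y),
        f = cat_comp h g -> section g \/ retraction h].
End Irreducible.

Record functor (C D : category) := Functor {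
  fun_ob :> C -> D;
  fun_hom : forall X Y : C, cat_hom X Y -> cat_hom (fun_ob X) (fun_ob Y);
  fun_id : forall X : C, fun_hom (cat_id X) = cat_id (fun_ob X);
  fun_comp : forall (X Y Z : C) (g : cat_hom Y Z) (f : cat_hom X Y),
    fun_hom (cat_comp g f) = cat_comp (fun_hom g) (fun_hom f) }.

Arguments fun_hom {C D} f0 {X Y}.

(* A zero object and binary biproducts are part of the structure, so that
   direct sums (of complexes, and in the compression functor) are functions;
   as always, the direct sums so chosen matter only up to isomorphism. *)
Record additive_category (k : comPzRingType) := AdditiveCategory {
  ob :> Type;
  hom : ob -> ob -> lmodType k;
  idm : forall A, hom A A;
  comp : forall A B C, hom B C -> hom A B -> hom A C;
  comp_idl : forall A B (f : hom A B), comp (idm B) f = f;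
  comp_idr : forall A B (f : hom A B), comp f (idm A) = f;
  comp_assoc : forall A B C D (h : hom C D) (g : hom B C) (f : hom A B),
    comp h (comp g f) = comp (comp h g) f;
  comp_linl : forall A B C (a : k) (g g' : hom B C) (f : hom A B),
    comp (a *: g + g') f = a *: comp g f + comp g' f;
  comp_linr : forall A B C (a : k) (g : hom B C) (f f' : hom A B),
    comp g (a *: f + f') = a *: comp g f + comp g f';
  zob : ob;
  zob_init : forall A (f : hom zob A), f = 0;
  zob_term : forall A (f : hom A zob), f = 0;
  bip : ob -> ob -> ob;
  inl_ : forall A B, hom A (bip A B);
  inr_ : forall A B, hom B (bip A B);
  prl_ : forall A B, hom (bip A B) A;
  prr_ : forall A B, hom (bip A B) B;
  prl_inl : forall A B, comp (prl_ A B) (inl_ A B) = idm A;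
  prr_inr : forall A B, comp (prr_ A B) (inr_ A B) = idm B;
  prl_inr : forall A B, comp (prl_ A B) (inr_ A B) = 0;
  prr_inl : forall A B, comp (prr_ A B) (inl_ A B) = 0;
  bip_id : forall A B, comp (inl_ A B) (prl_ A B) + comp (inr_ A B) (prr_ A B)
                       = idm (bip A B) }.

Arguments hom {k a0}.
Arguments idm {k a0}.
Arguments comp {k a0 A B C}.
Arguments zob {k a0}.
Arguments bip {k a0}.
Arguments inl_ {k a0 A B}.
Arguments inr_ {k a0 A B}.
Arguments prl_ {k a0 A B}.
Arguments prr_ {k a0 A B}.

Declare Scope acat_scope.
Delimit Scope acat_scope with acat.
Notation "g \oh f" := (comp g f) (at level 40, left associativity) : acat_scope.
Local Open Scope acat_scope.

Section AdditiveTheory.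
Variables (k : comPzRingType) (A : additive_category k).
Implicit Types X Y Z W : A.

Definition is_zero X : Prop :=
  (forall Y (f : hom X Y), f = 0) /\ (forall Y (f : hom Y X), f = 0).

Lemma compDl X Y Z (g g' : hom Y Z) (f : hom X Y) :
  (g + g') \oh f = g \oh f + g' \oh f.
Proof. by have := comp_linl 1 g g' f; rewrite !scale1r. Qed.

Lemma compDr X Y Z (g : hom Y Z) (f f' : hom X Y) :
  g \oh (f + f') = g \oh f + g \oh f'.
Proof. by have := comp_linr 1 g f f'; rewrite !scale1r. Qed.

Lemma comp0l X Y Z (f : hom X Y) : (0 : hom Y Z) \oh f = 0.
Proof. by apply: (addIr (0 \oh f)); rewrite -compDl !add0r. Qed.

Lemma comp0r X Y Z (g : hom Y Z) : g \oh (0 : hom X Y) = 0.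
Proof. by apply: (addIr (g \oh 0)); rewrite -compDr !add0r. Qed.

Lemma compZl X Y Z a (g : hom Y Z) (f : hom X Y) :
  (a *: g) \oh f = a *: (g \oh f).
Proof. by have := comp_linl a g 0 f; rewrite comp0l !addr0. Qed.

Lemma compZr X Y Z a (g : hom Y Z) (f : hom X Y) :
  g \oh (a *: f) = a *: (g \oh f).
Proof. by have := comp_linr a g f 0; rewrite comp0r !addr0. Qed.

Lemma is_zero_bip X Y : is_zero X -> is_zero Y -> is_zero (bip X Y).
Proof.
move=> [X1 X2] [Y1 Y2]; split=> Z f.
  by rewrite -(comp_idr f) -bip_id compDr (X2 _ prl_) (Y2 _ prr_) !comp0r addr0.
by rewrite -(comp_idl f) -bip_id compDl (X2 _ prl_) (Y2 _ prr_) !comp0r !comp0l addr0.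
Qed.

Definition bipmap X X' Y Y' (f : hom X Y) (g : hom X' Y') :
    hom (bip X X') (bip Y Y') :=
  inl_ \oh (f \oh prl_) + inr_ \oh (g \oh prr_).

Lemma bipmap_comp X X' Y Y' Z Z' (f : hom X Y) (f' : hom X' Y')
    (g : hom Y Z) (g' : hom Y' Z') :
  bipmap g g' \oh bipmap f f' = bipmap (g \oh f) (g' \oh f').
Proof.
rewrite /bipmap compDl !compDr -!comp_assoc.
rewrite (comp_assoc prl_ inl_) prl_inl (comp_assoc prl_ inr_) prl_inr.
rewrite (comp_assoc prr_ inl_) prr_inl (comp_assoc prr_ inr_) prr_inr.
by rewrite !comp_idl !comp0l !comp0r addr0 add0r.
Qed.

Lemma bipmap0 X X' Y Y' : bipmap (0 : hom X Y) (0 : hom X' Y') = 0.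
Proof. by rewrite /bipmap !comp0l !comp0r addr0. Qed.

Section FiniteSums.
Variable I : eqType.
Implicit Types (F G H : I -> A) (s t r : seq I).

Fixpoint bigbip F s : A :=
  if s is i :: s' then bip (F i) (bigbip F s') else zob.

Fixpoint row F s Y (u : forall i, hom (F i) Y) : hom (bigbip F s) Y :=
  if s is i :: s' return hom (bigbip F s) Y
  then u i \oh prl_ + row s' u \oh prr_ else 0.

Fixpoint col F s X (v : forall i, hom X (F i)) : hom X (bigbip F s) :=
  if s is i :: s' return hom X (bigbip F s)
  then inl_ \oh v i + inr_ \oh col s' v else 0.

(* The morphism of direct sums whose component from the summand F i to the
   summand G j is u i j. *)
Definition bigmx F G s t (u : forall i j, hom (F i) (G j)) :
    hom (bigbip F s) (bigbip G t) :=
  row s (fun i => col t (u i)).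

(* The matrix with entries f i : F i -> G i on the diagonal and 0 elsewhere. *)
Definition diag F G (f : forall i, hom (F i) (G i)) (i j : I) : hom (F i) (G j) :=
  match i =P j with
  | ReflectT e => ecast z (hom (F i) (G z)) e (f i)
  | ReflectF _ => 0
  end.

Lemma diag_eq F G (f : forall i, hom (F i) (G i)) i : diag f i i = f i.
Proof. by rewrite /diag; case: eqP => // e; rewrite eq_axiomK. Qed.

Lemma diag_neq F G (f : forall i, hom (F i) (G i)) i j :
  i != j -> diag f i j = 0.
Proof. by rewrite /diag; case: eqP. Qed.

Lemma comp_suml X Y Z s (u : I -> hom Y Z) (f : hom X Y) :
  (\sum_(i <- s) u i) \oh f = \sum_(i <- s) u i \oh f.
Proof.
by elim: s => [|i s IH]; rewrite ?big_nil ?comp0l // !big_cons compDl IH.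
Qed.

Lemma comp_sumr X Y Z s (g : hom Y Z) (u : I -> hom X Y) :
  g \oh (\sum_(i <- s) u i) = \sum_(i <- s) g \oh u i.
Proof.
by elim: s => [|i s IH]; rewrite ?big_nil ?comp0r // !big_cons compDr IH.
Qed.

Lemma row_col F s X Y (u : forall i, hom (F i) Y) (v : forall i, hom X (F i)) :
  row s u \oh col s v = \sum_(i <- s) u i \oh v i.
Proof.
elim: s => [|i s IH] /=; first by rewrite big_nil comp0l.
rewrite big_cons -IH compDl !compDr -!comp_assoc.
rewrite (comp_assoc prl_ inl_) prl_inl (comp_assoc prl_ inr_) prl_inr.
rewrite (comp_assoc prr_ inl_) prr_inl (comp_assoc prr_ inr_) prr_inr.
by rewrite !comp_idl !comp0l !comp0r addr0 add0r.
Qed.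

Lemma comp_row F s Y Z (h : hom Y Z) (u : forall i, hom (F i) Y) :
  h \oh row s u = row s (fun i => h \oh u i).
Proof.
by elim: s => [|i s IH] /=; rewrite ?comp0r // compDr !comp_assoc IH.
Qed.

Lemma eq_row F s Y (u u' : forall i, hom (F i) Y) :
  {in s, forall i, u i = u' i} -> row s u = row s u'.
Proof.
elim: s => [|i s IH] //= Hu; rewrite Hu ?mem_head // IH // => j js.
by apply: Hu; rewrite in_cons js orbT.
Qed.

Lemma eq_col F s X (v v' : forall i, hom X (F i)) :
  {in s, forall i, v i = v' i} -> col s v = col s v'.
Proof.
elim: s => [|i s IH] //= Hu; rewrite Hu ?mem_head // IH // => j js.
by apply: Hu; rewrite in_cons js orbT.
Qed.

Lemma col_comp F s X Y (v : forall i, hom Y (F i)) (h : hom X Y) :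
  col s v \oh h = col s (fun i => v i \oh h).
Proof.
by elim: s => [|i s IH] /=; rewrite ?comp0l // compDl -!comp_assoc IH.
Qed.

Lemma col0 F s X : col s (fun i => 0 : hom X (F i)) = 0.
Proof. by elim: s => [|i s IH] //=; rewrite IH !comp0r addr0. Qed.

Lemma row0 F s X : row s (fun i => 0 : hom (F i) X) = 0.
Proof. by elim: s => [|i s IH] //=; rewrite IH !comp0l addr0. Qed.

Lemma colD F s X (v v' : forall i, hom X (F i)) :
  col s (fun i => v i + v' i) = col s v + col s v'.
Proof.
by elim: s => [|i s IH] /=; rewrite ?addr0 // IH !compDr addrACA.
Qed.

Lemma col_sum F s X (J : Type) (r : seq J) (v : J -> forall i, hom X (F i)) :
  col s (fun i => \sum_(j <- r) v j i) = \sum_(j <- r) col s (v j).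
Proof.
elim: r => [|j r IH].
  by rewrite big_nil -[RHS](col0 F s X); apply: eq_col => i _; rewrite big_nil.
by rewrite big_cons -IH -colD; apply: eq_col => i _; rewrite big_cons.
Qed.

Lemma bigmx_comp F G H s t r (u : forall i j, hom (F i) (G j))
    (v : forall i j, hom (G i) (H j)) :
  bigmx t r v \oh bigmx s t u =
  bigmx s r (fun i l => \sum_(j <- t) v j l \oh u i j).
Proof.
rewrite /bigmx comp_row; apply: eq_row => i _.
by rewrite row_col col_sum; apply: eq_bigr => j _; rewrite col_comp.
Qed.

Lemma eq_bigmx F G s t (u u' : forall i j, hom (F i) (G j)) :
  {in s & t, forall i j, u i j = u' i j} -> bigmx s t u = bigmx s t u'.
Proof.
by move=> Hu; apply: eq_row => i si; apply: eq_col => j tj; apply: Hu.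
Qed.

Lemma bigmx0 F G s t : bigmx s t (fun i j => 0 : hom (F i) (G j)) = 0.
Proof.
by rewrite /bigmx -[RHS](row0 F s); apply: eq_row => i _; apply: col0.
Qed.

Lemma bigmx_id F s : uniq s -> bigmx s s (diag (fun i => idm (F i))) = idm _.
Proof.
elim: s => [|i s IH] /=; first by move=> _; rewrite [LHS]zob_init [RHS]zob_init.
case/andP=> nis us; rewrite /bigmx /= diag_eq comp_idr -bip_id.
have nij j : j \in s -> i != j by move=> js; apply: contraNneq nis => ->.
rewrite (_ : col s _ = 0); last first.
  rewrite -[RHS](col0 F s (F i)); apply: eq_col => j js.
  by rewrite diag_neq ?nij.
rewrite comp0r addr0; congr (_ + _ \oh _).
rewrite (@eq_row F s _ _ (fun j => inr_ \oh col s (diag (fun i => idm (F i)) j))).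
  by rewrite -comp_row -[row _ _]/(bigmx s s _) IH // comp_idr.
move=> j js; rewrite diag_neq; last by rewrite eq_sym nij.
by rewrite comp0r add0r.
Qed.

Lemma sum_diagr F G s Z (f : forall i, hom (F i) (G i)) (v : forall i, hom (G i) Z)
    i : uniq s -> (i \notin s -> is_zero (G i)) ->
  \sum_(j <- s) v j \oh diag f i j = v i \oh f i.
Proof.
move=> us Hi; have [si|si] := boolP (i \in s).
  rewrite (bigD1_seq i) //= diag_eq big1 ?addr0 // => j ji.
  by rewrite diag_neq ?comp0r // eq_sym.
rewrite (proj2 (Hi si) _ (f i)) comp0r big_seq big1 // => j js.
by rewrite diag_neq ?comp0r //; apply: contraNneq si => ->.
Qed.

Lemma sum_diagl F G s Z (f : forall i, hom (F i) (G i)) (v : forall i, hom Z (F i))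
    i : uniq s -> (i \notin s -> is_zero (F i)) ->
  \sum_(j <- s) diag f j i \oh v j = f i \oh v i.
Proof.
move=> us Hi; have [si|si] := boolP (i \in s).
  rewrite (bigD1_seq i) //= diag_eq big1 ?addr0 // => j ji.
  by rewrite diag_neq ?comp0l.
rewrite (proj1 (Hi si) _ (f i)) comp0l big_seq big1 // => j js.
by rewrite diag_neq ?comp0l //; apply: contraNneq si => <-.
Qed.

End FiniteSums.
End AdditiveTheory.

(* Complexes indexed by a type I with successor map nx.  The differential
   d^i : X^i -> X^(nx i) is stored as a family cd i j : X^i -> X^j that vanishes
   unless j = nx i, so that no transport along equalities of indices is needed.
   - (int, i |-> i + 1) gives cochain complexes;
   - ('I_m, ordS), i.e. Z/m with i |-> i + 1 mod m, gives m-periodic complexes: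
     a complex (X^i, d^i) over Z with X^i and d^i depending only on the class of
     i mod m is the same thing as a family indexed by Z/m, and likewise for chain
     maps.  For m = 1 this is an object X with d : X -> X and d \oh d = 0. *)
Section Complexes.
Variables (k : comPzRingType) (A : additive_category k).
Variables (I : eqType) (nx : I -> I).

Record complex := Complex {
  cob :> I -> A;
  cd : forall i j, hom (cob i) (cob j);
  cd_shape : forall i j, j != nx i -> cd i j = 0;
  cd_sq : forall i j l, cd j l \oh cd i j = 0 }.

Record chain_map (X Y : complex) := ChainMap {
  cm :> forall i, hom (X i) (Y i);
  cm_comm : forall i j, cm j \oh cd X i j = cd Y i j \oh cm i }.

Lemma chain_map_eq X Y (f g : chain_map X Y) : (forall i, f i = g i) -> f = g.
Proof.
case: f g => [f Hf] [g Hg] /= fg.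
have e : f = g by apply: functional_extensionality_dep.
by case: _ / e Hg => Hg; congr ChainMap; apply: Prop_irrelevance.
Qed.

Lemma chain_id_comm (X : complex) i j :
  idm (X j) \oh cd X i j = cd X i j \oh idm (X i).
Proof. by rewrite comp_idl comp_idr. Qed.

Definition chain_id X : chain_map X X := ChainMap (@chain_id_comm X).

Lemma chain_comp_comm X Y Z (g : chain_map Y Z) (f : chain_map X Y) i j :
  (g j \oh f j) \oh cd X i j = cd Z i j \oh (g i \oh f i).
Proof. by rewrite -comp_assoc cm_comm !comp_assoc cm_comm. Qed.

Definition chain_comp X Y Z (g : chain_map Y Z) (f : chain_map X Y) :
  chain_map X Z := ChainMap (chain_comp_comm g f).

Lemma chain_idl X Y (f : chain_map X Y) : chain_comp (chain_id Y) f = f.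
Proof. by apply: chain_map_eq => i; apply: comp_idl. Qed.

Lemma chain_idr X Y (f : chain_map X Y) : chain_comp f (chain_id X) = f.
Proof. by apply: chain_map_eq => i; apply: comp_idr. Qed.

Lemma chain_assoc X Y Z W (h : chain_map Z W) (g : chain_map Y Z)
  (f : chain_map X Y) :
  chain_comp h (chain_comp g f) = chain_comp (chain_comp h g) f.
Proof. by apply: chain_map_eq => i; apply: comp_assoc. Qed.

Definition complex_cat : category :=
  @Category complex chain_map chain_id chain_comp chain_idl chain_idr chain_assoc.

Section DirectSum.
Variables X Y : complex.

Let dsob i := bip (X i) (Y i).
Let dsd i j : hom (dsob i) (dsob j) := bipmap (cd X i j) (cd Y i j).

Lemma dsum_shape i j : j != nx i -> dsd i j = 0.
Proof. by move=> ji; rewrite /dsd !cd_shape // bipmap0. Qed.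

Lemma dsum_sq i j l : dsd j l \oh dsd i j = 0.
Proof. by rewrite bipmap_comp !cd_sq bipmap0. Qed.

Definition dsum : complex := Complex dsum_shape dsum_sq.
End DirectSum.

End Complexes.

Notation cochain A := (complex A (fun i : int => (i + 1)%R)).

Section BoundedComplexes.
Variables (k : comPzRingType) (A : additive_category k).

Definition bounded (X : cochain A) : Prop :=
  exists N : nat, forall i : int, (N < `|i|)%N -> is_zero (X i).

Record bcomplex := BComplex { bcx :> cochain A; bcxP : bounded bcx }.

Definition Cb : category :=
  @Category bcomplex (fun X Y => chain_map X Y) (fun X => chain_id X)
    (fun X Y Z g f => chain_comp g f)
    (fun X Y f => chain_idl f) (fun X Y f => chain_idr f)
    (fun X Y Z W h g f => chain_assoc h g f).

Lemma bounded_dsum (X Y : bcomplex) : bounded (dsum X Y).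
Proof.
case: (bcxP X) (bcxP Y) => [M HM] [N HN]; exists (maxn M N) => i.
by rewrite gtn_max => /andP[Mi Ni]; apply: is_zero_bip; [exact: HM|exact: HN].
Qed.

Definition bdsum (X Y : bcomplex) : bcomplex := BComplex (bounded_dsum X Y).

Section Shift.
Variables (X : cochain A) (t : int).

Let shd i j : hom (X (i + t)) (X (j + t)) := (-1) ^+ `|t|%N *: cd X (i + t) (j + t).

Lemma shift_shape i j : j != i + 1 -> shd i j = 0.
Proof.
move=> ji; rewrite /shd cd_shape ?scaler0 //.
by apply: contraNneq ji => e; apply/eqP; lia.
Qed.

Lemma shift_sq i j l : shd j l \oh shd i j = 0.
Proof. by rewrite compZl compZr cd_sq !scaler0. Qed.

Definition shift : cochain A :=
  @Complex k A int (fun i => i + 1) (fun i => X (i + t)) shd shift_shape shift_sq.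
End Shift.

Definition in_C1n (n : nat) (X : cochain A) : Prop :=
  forall i : int, ~~ (1 <= i <= n%:Z) -> is_zero (X i).

Definition size_spec (W : cochain A) (n : nat) : Prop :=
  (0 < n)%N /\ exists t : int, in_C1n n (shift W t).

Lemma size_exists (W : bcomplex) : exists n, `[< size_spec W n >].
Proof.
case: (bcxP W) => N HN; exists N.*2.+1; apply/asboolP; split=> //.
exists (- N.+1%:Z) => i Hi; apply: HN; lia.
Qed.

(* The size l(W): the least n > 0 such that some shift of W lies in [1, n]. *)
Definition csize (W : bcomplex) : nat := ex_minn (size_exists W).

End BoundedComplexes.

Section Compression.
Variables (k : comPzRingType) (A : additive_category k) (m : nat).

Definition Cper : category := complex_cat A (@ordS m).

(* The integers t with |t| <= N. *)
Definition window (N : nat) : seq int := [seq x%:Z - N%:Z | x <- iota 0 N.*2.+1].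

Lemma window_uniq N : uniq (window N).
Proof. by rewrite map_inj_uniq ?iota_uniq // => x y /addIr[]. Qed.

Lemma mem_window N t : (t \in window N) = (`|t| <= N)%N.
Proof.
apply/mapP/idP => [[x]|tN]; first by rewrite mem_iota => ?; lia.
by exists (absz (t + N%:Z)); [rewrite mem_iota|]; lia.
Qed.

Definition bound (X : bcomplex A) : nat := sval (cid (bcxP X)).

Lemma boundP (X : bcomplex A) (i : int) : (bound X < `|i|)%N -> is_zero (X i).
Proof. by rewrite /bound; case: cid => N /= HN /HN. Qed.

Definition idx (i : 'I_m) (t : int) : int := (i : nat)%:Z + t * m%:Z.

Lemma idx_window (X : bcomplex A) i t :
  t \notin window (bound X) -> is_zero (X (idx i t)).
Proof.
rewrite mem_window -ltnNge => Ht; apply: boundP.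
have := ltn_ord i; rewrite /idx; move: (nat_of_ord i) (bound X) Ht => a N Ht am.
have [t0|t0] := Num.Theory.lerP 0 t.
  have : t * 1 <= t * m%:Z by apply: Num.Theory.ler_wpM2l => //; lia.
  lia.
have : (- t - 1) * 1 <= (- t - 1) * m%:Z by apply: Num.Theory.ler_wpM2l; lia.
lia.
Qed.

Lemma idx_succ i j t t' : idx j t' = idx i t + 1 -> j = ordS i.
Proof.
rewrite /idx => e; apply: val_inj => /=.
have : (j%:Z = (i.+1)%:Z %[mod m%:Z])%Z.
  have -> : (i.+1)%:Z = (t' - t) * m%:Z + j%:Z by lia.
  by rewrite modzMDl.
by rewrite !modz_nat => -[]; rewrite modn_small.
Qed.

Section Object.
Variable X : bcomplex A.

(* F_m(X)^i is the direct sum of the X^(i + t m) for all integers t; all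
   summands outside the window are zero objects (idx_window). *)
Definition Fm_ob (i : 'I_m) : A :=
  bigbip (fun t => X (idx i t)) (window (bound X)).

(* The (t, t') component X^(i + t m) -> X^(j + t' m) is d_X when
   j + t' m = i + t m + 1, and 0 otherwise. *)
Definition Fm_d (i j : 'I_m) : hom (Fm_ob i) (Fm_ob j) :=
  bigmx _ _ (fun t t' => cd X (idx i t) (idx j t')).

Lemma Fm_shape i j : j != ordS i -> Fm_d i j = 0.
Proof.
move=> ji; rewrite -[RHS]bigmx0; apply: eq_bigmx => t t' _ _.
by apply: cd_shape; apply: contraNneq ji => /idx_succ ->.
Qed.

Lemma Fm_sq i j l : Fm_d j l \oh Fm_d i j = 0.
Proof.
rewrite /Fm_d bigmx_comp -[RHS]bigmx0; apply: eq_bigmx => t t' _ _.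
by rewrite big1 // => t'' _; apply: cd_sq.
Qed.

Definition Fm_complex : Cper := Complex Fm_shape Fm_sq.
End Object.

Section Morphism.
Variables (X Y : bcomplex A) (f : chain_map X Y).

Definition Fm_cm (i : 'I_m) : hom (Fm_complex X i) (Fm_complex Y i) :=
  bigmx _ _ (diag (fun t => f (idx i t))).

Lemma Fm_comm i j :
  Fm_cm j \oh cd (Fm_complex X) i j = cd (Fm_complex Y) i j \oh Fm_cm i.
Proof.
rewrite /Fm_cm /= /Fm_d !bigmx_comp; apply: eq_bigmx => t t' _ _.
rewrite (sum_diagl (fun t => f (idx j t))) ?window_uniq //; last exact: idx_window.
rewrite (sum_diagr (fun t => f (idx i t)) (fun a => cd Y (idx i a) (idx j t')))
  ?window_uniq //; last exact: idx_window.
exact: cm_comm.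
Qed.

Definition Fm_map : chain_map (Fm_complex X) (Fm_complex Y) := ChainMap Fm_comm.
End Morphism.

Lemma Fm_id (X : bcomplex A) : Fm_map (chain_id X) = chain_id (Fm_complex X).
Proof. by apply: chain_map_eq => i; apply: bigmx_id; apply: window_uniq. Qed.

Lemma Fm_comp (X Y Z : bcomplex A) (g : chain_map Y Z) (f : chain_map X Y) :
  Fm_map (chain_comp g f) = chain_comp (Fm_map g) (Fm_map f).
Proof.
apply: chain_map_eq => i; rewrite /= /Fm_cm bigmx_comp; apply: eq_bigmx => t t' _ _.
rewrite (sum_diagr (fun t => f (idx i t))
          (fun a => diag (fun t => g (idx i t)) a t')) ?window_uniq //; last exact: idx_window.
have [<-|tt'] := eqVneq t t'; first by rewrite !diag_eq.
by rewrite !diag_neq // comp0l.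
Qed.

Definition Fm : functor (Cb A) Cper :=
  @Functor (Cb A) Cper Fm_complex Fm_map Fm_id Fm_comp.

End Compression.

(* Main.v *)
From mathcomp Require Import all_boot all_order all_algebra.
From mathcomp Require Import boolp zify.
Require Import Defs.

(** Write [F] for the compression functor.  Sending an [m]-periodic complex [Z] to
the unbounded cochain complex [unroll Z] with [Z^(j mod m)] in degree [j] is a
functor, and [F] behaves like an adjoint of it on both sides, since
[F X] is at once the coproduct and the product of the objects [X^j] with [j] in a
given residue class.  There are natural chain maps
[X -> unroll (F X) -> X] ([Fm_unit] and [Fm_counit]) whose composite is the
identity of [X].

If [r] is a left inverse of [F f], then [Fm_counit \o unroll r \o Fm_unit], the part
of [r] that preserves the degree, is a left inverse of [f]; the same holds for right
inverses.  Hence [F] reflects sections and retractions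
([section_Fm_reflect], [retraction_Fm_reflect]), so [f] is irreducible as soon as
[F f] is.

For the converse, let [f] be irreducible and [F f = h g] through a periodic complex
[Z].  Unrolling gives a factorization
[f = (Fm_counit \o unroll h) \o (unroll g \o Fm_unit)] through [unroll Z],
which is usually not bounded.  Truncating it brutally, strictly outside the degrees
that [X] and [Y] occupy, yields a bounded complex to which irreducibility applies, and
the splitting so obtained extends to [unroll Z] ([irreducible_factor_cochain]).
A left inverse [r : unroll Z -> X] of the first factor is then folded back to a
chain map [Z -> F X] whose components are those of [r].  Its composite with [g] has
the identities of the [X^j] on the diagonal, and off the diagonal it has maps
[X^j -> X^l] with [j <> l] congruent modulo [m].  The bound on the size forces these
to vanish, because [X] has at most one nonzero object in each residue class
([csize_spread], [fold_section]).  Right inverses are treated dually. *)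

Set Implicit Arguments.
Unset Strict Implicit.
Unset Printing Implicit Defensive.

Import GRing.Theory.
Local Open Scope ring_scope.
Local Open Scope acat_scope.

(** * Diagonal matrices and summands of zero objects *)

Section Diagonal.
Variables (k : comPzRingType) (A : additive_category k) (I : eqType).
Implicit Types (F : I -> A) (W : A).

Lemma comp_diag_idr F W (u : forall i, hom (F i) W) i j :
  u j \oh diag (fun i => idm (F i)) i j = if i == j then u i else 0.
Proof.
by case: eqVneq => [<-|ij]; rewrite ?diag_eq ?comp_idr // diag_neq ?comp0r.
Qed.

Lemma comp_diag_idl F W (v : forall i, hom W (F i)) i j :
  diag (fun i => idm (F i)) i j \oh v i = if i == j then v j else 0.
Proof.
by case: eqVneq => [<-|ij]; rewrite ?diag_eq ?comp_idl // diag_neq ?comp0l.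
Qed.

Lemma diag_idl F G (f : forall i, hom (F i) (G i)) i j :
  diag (fun i => idm (G i)) i j \oh f i = diag f i j.
Proof.
by have [<-|ij] := eqVneq i j; rewrite ?diag_eq ?comp_idl // !diag_neq ?comp0l.
Qed.

Lemma diag_idr F G (f : forall i, hom (F i) (G i)) i j :
  f j \oh diag (fun i => idm (F i)) i j = diag f i j.
Proof.
by have [<-|ij] := eqVneq i j; rewrite ?diag_eq ?comp_idr // !diag_neq ?comp0r.
Qed.

Lemma diag_reindex (J : eqType) (p : J -> I) F G (f : forall i, hom (F i) (G i)) s t :
  injective p -> diag (fun t => f (p t)) s t = diag f (p s) (p t).
Proof.
move=> p_inj; have [<-|st] := eqVneq s t; first by rewrite !diag_eq.
by rewrite !diag_neq // (inj_eq p_inj).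
Qed.

End Diagonal.

Lemma is_zero_bipl (k : comPzRingType) (A : additive_category k) (X Y : A) :
  is_zero (bip X Y) -> is_zero X.
Proof.
move=> [z1 z2]; split=> W f.
  by rewrite -(comp_idr f) -(prl_inl X Y) (z1 _ prl_) comp0l comp0r.
by rewrite -(comp_idl f) -(prl_inl X Y) (z1 _ prl_) !comp0l.
Qed.

Lemma is_zero_bipr (k : comPzRingType) (A : additive_category k) (X Y : A) :
  is_zero (bip X Y) -> is_zero Y.
Proof.
move=> [z1 z2]; split=> W f.
  by rewrite -(comp_idr f) -(prr_inr X Y) (z1 _ prr_) comp0l comp0r.
by rewrite -(comp_idl f) -(prr_inr X Y) (z1 _ prr_) !comp0l.
Qed.

(** * Brutal truncation and factorizations through unbounded complexes *)

Section Truncation.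
Variables (k : comPzRingType) (A : additive_category k) (W : cochain A) (N : nat).

Definition trunc_ob (j : int) : A := if (`|j| <= N)%N then W j else zob.

(** Neither family [to_trunc], [of_trunc] is a chain map in general: the first fails
at the lower end of the window and the second at the upper end. *)
Definition to_trunc j : hom (W j) (trunc_ob j) :=
  if (`|j| <= N)%N as b return hom (W j) (if b then W j else zob)
  then idm (W j) else 0.

Definition of_trunc j : hom (trunc_ob j) (W j) :=
  if (`|j| <= N)%N as b return hom (if b then W j else zob) (W j)
  then idm (W j) else 0.

Lemma to_truncK j : of_trunc j \oh to_trunc j = if (`|j| <= N)%N then idm (W j) else 0.
Proof.
by rewrite /of_trunc /to_trunc /trunc_ob; case: leqP => _;
  rewrite ?comp_idl ?comp0l.
Qed.

Definition trunc_d i j : hom (trunc_ob i) (trunc_ob j) :=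
  to_trunc j \oh (cd W i j \oh of_trunc i).

Lemma trunc_shape i j : j != i + 1 -> trunc_d i j = 0.
Proof. by move=> ji; rewrite /trunc_d cd_shape // comp0l comp0r. Qed.

Lemma trunc_sq i j l : trunc_d j l \oh trunc_d i j = 0.
Proof.
rewrite /trunc_d -!comp_assoc (comp_assoc (of_trunc j)) to_truncK.
case: ifP => _; last by rewrite !(comp0l, comp0r).
by rewrite comp_idl (comp_assoc (cd W j l)) cd_sq comp0l comp0r.
Qed.

Definition trunc_complex : cochain A :=
  @Complex _ _ _ (fun i : int => i + 1) trunc_ob trunc_d trunc_shape trunc_sq.

Lemma trunc_bounded : bounded trunc_complex.
Proof.
exists N => i Ni; rewrite /= /trunc_ob leqNgt Ni /=.
by split=> V f; [apply: zob_init|apply: zob_term].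
Qed.

Definition trunc : bcomplex A := BComplex trunc_bounded.

(* The objects of X vanish not only outside the window |j| <= N but also at its two
   ends: a map between X and the truncation extends to W only if it is compatible with
   the differentials of W that enter or leave the window, and these meet the window at
   its ends. *)
Section Transfer.
Variable X : cochain A.
Hypothesis X0 : forall j : int, (N <= `|j|)%N -> is_zero (X j).

Lemma map_to_trunc_comm (g : chain_map X W) i j :
  (to_trunc j \oh g j) \oh cd X i j = cd trunc i j \oh (to_trunc i \oh g i).
Proof.
rewrite -comp_assoc cm_comm /= /trunc_d -!comp_assoc (comp_assoc (of_trunc i)).
rewrite to_truncK; case: leqP => Ni; first by rewrite comp_idl.
by rewrite (proj1 (X0 (ltnW Ni)) _ (g i)) !comp0r.
Qed.

Definition map_to_trunc (g : chain_map X W) : chain_map X trunc :=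
  @ChainMap _ _ _ _ X trunc (fun j => to_trunc j \oh g j) (map_to_trunc_comm g).

Lemma map_of_trunc_comm (h : chain_map W X) i j :
  (h j \oh of_trunc j) \oh cd trunc i j = cd X i j \oh (h i \oh of_trunc i).
Proof.
rewrite !comp_assoc -cm_comm /= /trunc_d -!comp_assoc.
rewrite (comp_assoc (of_trunc j)) to_truncK; case: leqP => Nj; first by rewrite comp_idl.
by rewrite (proj2 (X0 (ltnW Nj)) _ (h j)) !comp0l.
Qed.

Definition map_of_trunc (h : chain_map W X) : chain_map trunc X :=
  @ChainMap _ _ _ _ trunc X (fun j => h j \oh of_trunc j) (map_of_trunc_comm h).

Lemma next_outside i j : (N < `|i|)%N -> j = i + 1 -> (N <= `|j|)%N.
Proof. by move=> Ni ->; lia. Qed.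

Lemma lift_from_trunc_comm (r : chain_map trunc X) i j :
  (r j \oh to_trunc j) \oh cd W i j = cd X i j \oh (r i \oh to_trunc i).
Proof.
rewrite (comp_assoc (cd X i j)) -cm_comm /= /trunc_d -!comp_assoc to_truncK.
case: leqP => Ni; first by rewrite comp_idr.
rewrite !comp0r; have [e|ne] := eqVneq j (i + 1); last by rewrite cd_shape ?comp0r.
by rewrite (proj2 (X0 (next_outside Ni e)) _ (r j)) comp0l.
Qed.

Definition lift_from_trunc (r : chain_map trunc X) : chain_map W X :=
  @ChainMap _ _ _ _ W X (fun j => r j \oh to_trunc j) (lift_from_trunc_comm r).

Lemma lift_to_trunc_comm (r : chain_map X trunc) i j :
  (of_trunc j \oh r j) \oh cd X i j = cd W i j \oh (of_trunc i \oh r i).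
Proof.
rewrite -comp_assoc (cm_comm r) /= /trunc_d !comp_assoc to_truncK.
case: leqP => Nj; first by rewrite comp_idl.
rewrite !comp0l; have [e|ne] := eqVneq j (i + 1); last by rewrite cd_shape ?comp0l.
have Ni : (N <= `|i|)%N by move: Nj e; lia.
by rewrite (proj1 (X0 Ni) _ (r i)) comp0r.
Qed.

Definition lift_to_trunc (r : chain_map X trunc) : chain_map X W :=
  @ChainMap _ _ _ _ X W (fun j => of_trunc j \oh r j) (lift_to_trunc_comm r).

End Transfer.
End Truncation.

(** Irreducibility only speaks of bounded middle terms, but both splittings can be
transferred between [W] and its truncation to a large enough window. *)
Lemma irreducible_factor_cochain (k : comPzRingType) (A : additive_category k)
    (X Y : Cb A) (f : cat_hom X Y) (W : cochain A)
    (g : chain_map X W) (h : chain_map W Y) :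
  irreducible f -> f = chain_comp h g ->
  (exists r, chain_comp r g = chain_id X) \/ (exists r, chain_comp h r = chain_id Y).
Proof.
move=> [_ _ irrf] fhg.
case: (bcxP X) (bcxP Y) => [M HM] [M' HM'].
(* The successor makes X and Y vanish at the ends of the window as well. *)
pose N := (maxn M M').+1.
have X0 (j : int) : (N <= `|j|)%N -> is_zero (X j) by move=> Nj; apply: HM; lia.
have Y0 (j : int) : (N <= `|j|)%N -> is_zero (Y j) by move=> Nj; apply: HM'; lia.
have fT : f = cat_comp (map_of_trunc Y0 h : cat_hom (trunc W N : Cb A) Y)
                       (map_to_trunc X0 g).
  apply: chain_map_eq => j; rewrite fhg /= -!comp_assoc (comp_assoc (of_trunc _ _ j)).
  rewrite to_truncK; case: leqP => Nj; first by rewrite comp_idl.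
  by rewrite (proj1 (X0 _ (ltnW Nj)) _ (g j)) !comp0r.
case: (irrf _ _ _ fT) => -[r /(congr1 (fun u : chain_map _ _ => cm u)) rE].
  left; exists (lift_from_trunc X0 r); apply: chain_map_eq => j /=.
  by have := congr1 (fun u => u j) rE; rewrite /= -comp_assoc.
right; exists (lift_to_trunc Y0 r); apply: chain_map_eq => j /=.
by have := congr1 (fun u => u j) rE; rewrite /= comp_assoc.
Qed.

(** * Unrolling periodic complexes *)

Section Unroll.
Variables (k : comPzRingType) (A : additive_category k) (m : nat).
Hypothesis m_gt0 : (0 < m)%N.

Lemma residue_lt (j : int) : (`|(j %% m%:Z)%Z| < m)%N.
Proof. by have := @modz_ge0 j m%:Z; have := @ltz_pmod j m%:Z; lia. Qed.

Definition residue (j : int) : 'I_m := Ordinal (residue_lt j).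

Lemma residueE j : (residue j)%:Z = (j %% m%:Z)%Z.
Proof. by rewrite /=; have := @modz_ge0 j m%:Z; lia. Qed.

Lemma idx_residue (j : int) : j = idx (residue j) (j %/ m%:Z)%Z.
Proof. by rewrite /idx residueE addrC -divz_eq. Qed.

Lemma residue_idx (i : 'I_m) t : residue (idx i t) = i.
Proof.
apply: val_inj; apply/eqP; rewrite -eqz_nat residueE /idx addrC modzMDl.
by rewrite modz_small //; have := ltn_ord i; lia.
Qed.

Lemma idx_inj (i : 'I_m) : injective (@idx m i).
Proof.
move=> t t' /addrI /eqP; rewrite -subr_eq0 -mulrBl mulf_eq0 subr_eq0.
by case/orP => /eqP //; lia.
Qed.

Lemma residueS j : residue (j + 1) = ordS (residue j).
Proof.
by apply: (@idx_succ m _ _ (j %/ m%:Z)%Z ((j + 1) %/ m%:Z)%Z); rewrite -!idx_residue.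
Qed.

Section Object.
Variable Z : Cper A m.

Definition unroll_d i j : hom (Z (residue i)) (Z (residue j)) :=
  if j == i + 1 then cd Z (residue i) (residue j) else 0.

Lemma unroll_shape i j : j != i + 1 -> unroll_d i j = 0.
Proof. by rewrite /unroll_d => /negbTE ->. Qed.

Lemma unroll_sq i j l : unroll_d j l \oh unroll_d i j = 0.
Proof. by rewrite /unroll_d; do 2!case: ifP => _; rewrite ?cd_sq ?comp0l ?comp0r. Qed.

Definition unroll : cochain A :=
  @Complex _ _ _ (fun i : int => i + 1) (fun i => Z (residue i)) unroll_d
    unroll_shape unroll_sq.

Lemma unroll_dS i : cd unroll i (i + 1) = cd Z (residue i) (residue (i + 1)).
Proof. by rewrite /= /unroll_d eqxx. Qed.
End Object.

Lemma cochain_comm (X Y : cochain A) (f : forall i, hom (X i) (Y i)) :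
  (forall i, f (i + 1) \oh cd X i (i + 1) = cd Y i (i + 1) \oh f i) ->
  forall i j, f j \oh cd X i j = cd Y i j \oh f i.
Proof.
move=> fd i j; have [->|ij] := eqVneq j (i + 1); first exact: fd.
by rewrite !cd_shape // comp0l comp0r.
Qed.

Lemma unroll_map_comm (Z Z' : Cper A m) (f : chain_map Z Z') i :
  f (residue (i + 1)) \oh cd (unroll Z) i (i + 1)
  = cd (unroll Z') i (i + 1) \oh f (residue i).
Proof. by rewrite !unroll_dS; exact (cm_comm f _ _). Qed.

Definition unroll_map (Z Z' : Cper A m) (f : chain_map Z Z') :
    chain_map (unroll Z) (unroll Z') :=
  @ChainMap _ _ _ _ (unroll Z) (unroll Z') (fun j => f (residue j))
    (@cochain_comm (unroll Z) (unroll Z') (fun j => f (residue j)) (unroll_map_comm f)).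

Lemma unroll_map_id Z : unroll_map (chain_id Z) = chain_id (unroll Z).
Proof. exact: chain_map_eq. Qed.

Lemma unroll_map_comp (Z Z' Z'' : Cper A m) (g : chain_map Z' Z'') (f : chain_map Z Z') :
  unroll_map (chain_comp g f) = chain_comp (unroll_map g) (unroll_map f).
Proof. exact: chain_map_eq. Qed.

(** * The summands of a compressed complex *)

Section Components.
Variable X : bcomplex A.

(** The inclusion of the summand [X^j] of [F(X)^i], and 0 when [j] is not of residue
[i].  Indexing it by [j] rather than by the block number [t] with [j = i + t m], and
writing it as a column of the identity matrix, avoids transports along that
equality. *)
Definition Fm_in (i : 'I_m) (j : int) : hom (X j) (Fm_ob X i) :=
  col _ (fun t => diag (fun l => idm (X l)) j (idx i t)).

Definition Fm_out (i : 'I_m) (j : int) : hom (Fm_ob X i) (X j) :=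
  row _ (fun t => diag (fun l => idm (X l)) (idx i t) j).

(** A degree [j] outside the window of the direct sum causes no trouble: [X^j] is then
a zero object and both sides vanish. *)
Lemma row_Fm_in V (i : 'I_m) j (u : forall j, hom (X j) V) : residue j = i ->
  row (window (bound X)) (fun t => u (idx i t)) \oh Fm_in i j = u j.
Proof.
move=> ji; move: (idx_residue j); rewrite ji; move: (_ %/ _)%Z => t0 ->.
rewrite /Fm_in row_col.
rewrite -[RHS]comp_idr -(sum_diagr (fun t => idm (X (idx i t)))
   (fun t => u (idx i t)) (window_uniq (bound X))); last exact: idx_window.
apply: eq_bigr => t _; rewrite (comp_diag_idr u).
by rewrite (comp_diag_idr (fun t => u (idx i t))) (inj_eq (@idx_inj i)).
Qed.

Lemma Fm_out_col V (i : 'I_m) j (v : forall j, hom V (X j)) : residue j = i ->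
  Fm_out i j \oh col (window (bound X)) (fun t => v (idx i t)) = v j.
Proof.
move=> ji; move: (idx_residue j); rewrite ji; move: (_ %/ _)%Z => t0 ->.
rewrite /Fm_out row_col.
rewrite -[RHS]comp_idl -(sum_diagl (fun t => idm (X (idx i t)))
   (fun t => v (idx i t)) (window_uniq (bound X))); last exact: idx_window.
apply: eq_bigr => t _; rewrite (comp_diag_idl v).
by rewrite (comp_diag_idl (fun t => v (idx i t))) (inj_eq (@idx_inj i)).
Qed.

Lemma Fm_in_out i : row (window (bound X)) (fun t => Fm_in i (idx i t)) = idm (Fm_ob X i).
Proof.
rewrite -[RHS](bigmx_id _ (window_uniq (bound X))) /bigmx; apply: eq_row => t _.
apply: eq_col => t' _; have [<-|tt'] := eqVneq t t'; first by rewrite !diag_eq.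
by rewrite !diag_neq // (inj_eq (@idx_inj i)).
Qed.

Lemma Fm_out_in i j j' : residue j = i ->
  Fm_out i j' \oh Fm_in i j = diag (fun l => idm (X l)) j j'.
Proof. exact: (row_Fm_in (fun l => diag (fun l => idm (X l)) l j')). Qed.

Lemma Fm_in_ext V i (f g : hom (Fm_ob X i) V) :
  (forall j, residue j = i -> f \oh Fm_in i j = g \oh Fm_in i j) -> f = g.
Proof.
move=> fg; rewrite -[f]comp_idr -[g]comp_idr -Fm_in_out !comp_row.
by apply: eq_row => t _; apply: fg; apply: residue_idx.
Qed.

Lemma Fm_out_ext V i (f g : hom V (Fm_ob X i)) :
  (forall j, residue j = i -> Fm_out i j \oh f = Fm_out i j \oh g) -> f = g.
Proof.
have outE : col (window (bound X)) (fun t => Fm_out i (idx i t)) = idm (Fm_ob X i).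
  apply: Fm_in_ext => j ji; rewrite comp_idl col_comp; apply: eq_col => t _.
  exact: Fm_out_in.
move=> fg; rewrite -[f]comp_idl -[g]comp_idl -outE !col_comp.
by apply: eq_col => t _; apply: fg; apply: residue_idx.
Qed.

(** The inclusions commute with the differentials, and so do the projections below,
because the differential of [F X] has no components other than those of [X]. *)
Lemma Fm_unit_comm j :
  Fm_in (residue (j + 1)) (j + 1) \oh cd X j (j + 1)
  = cd (unroll (Fm_complex m X)) j (j + 1) \oh Fm_in (residue j) j.
Proof.
rewrite unroll_dS /= /Fm_d /bigmx.
rewrite (row_Fm_in (fun j' => col _ (fun t' => cd X j' (idx (residue (j + 1)) t')))) //.
rewrite /Fm_in col_comp; apply: eq_col => t _; set l := idx _ t.
have [<-|ne] := eqVneq (j + 1) l; first by rewrite diag_eq comp_idl.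
by rewrite diag_neq // comp0l cd_shape // eq_sym.
Qed.

Lemma Fm_counit_comm j :
  Fm_out (residue (j + 1)) (j + 1) \oh cd (unroll (Fm_complex m X)) j (j + 1)
  = cd X j (j + 1) \oh Fm_out (residue j) j.
Proof.
rewrite unroll_dS /=; apply: Fm_in_ext => l lj.
rewrite -!comp_assoc Fm_out_in // /Fm_d /bigmx.
rewrite (row_Fm_in (fun j' => col _ (fun t' => cd X j' (idx (residue (j + 1)) t')))) //.
rewrite (Fm_out_col (fun j' => cd X l j')) //.
have [->|ne] := eqVneq l j; first by rewrite diag_eq comp_idr.
by rewrite diag_neq // comp0r cd_shape // (inj_eq (addIr 1)) eq_sym.
Qed.

Definition Fm_unit : chain_map X (unroll (Fm_complex m X)) :=
  @ChainMap _ _ _ _ X (unroll (Fm_complex m X)) (fun j => Fm_in (residue j) j)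
    (@cochain_comm X (unroll (Fm_complex m X)) (fun j => Fm_in (residue j) j) Fm_unit_comm).

Definition Fm_counit : chain_map (unroll (Fm_complex m X)) X :=
  @ChainMap _ _ _ _ (unroll (Fm_complex m X)) X (fun j => Fm_out (residue j) j)
    (@cochain_comm (unroll (Fm_complex m X)) X (fun j => Fm_out (residue j) j)
       Fm_counit_comm).

Lemma Fm_unitK : chain_comp Fm_counit Fm_unit = chain_id X.
Proof. by apply: chain_map_eq => j; rewrite /= Fm_out_in // diag_eq. Qed.

End Components.

Lemma Fm_cm_in (X Y : bcomplex A) (f : chain_map X Y) i j : residue j = i ->
  Fm_cm f i \oh Fm_in X i j = Fm_in Y i j \oh f j.
Proof.
move=> ji; rewrite /Fm_cm /bigmx.
rewrite (eq_row (u' := fun t => col _ (fun t' => diag f (idx i t) (idx i t')))).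
  rewrite (row_Fm_in (fun l => col _ (fun t' => diag f l (idx i t')))) //.
  by rewrite /Fm_in col_comp; apply: eq_col => t _; rewrite diag_idl.
by move=> t _; apply: eq_col => t' _; apply: diag_reindex (@idx_inj i).
Qed.

Lemma Fm_cm_out (X Y : bcomplex A) (f : chain_map X Y) i j : residue j = i ->
  Fm_out Y i j \oh Fm_cm f i = f j \oh Fm_out X i j.
Proof.
move=> ji; apply: Fm_in_ext => l li; rewrite -!comp_assoc Fm_cm_in //.
by rewrite comp_assoc !Fm_out_in // diag_idl diag_idr.
Qed.

Lemma Fm_unit_nat (X Y : bcomplex A) (f : chain_map X Y) :
  chain_comp (unroll_map (Fm_map m f)) (Fm_unit X) = chain_comp (Fm_unit Y) f.
Proof. by apply: chain_map_eq => j; apply: Fm_cm_in. Qed.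

Lemma Fm_counit_nat (X Y : bcomplex A) (f : chain_map X Y) :
  chain_comp (Fm_counit Y) (unroll_map (Fm_map m f)) = chain_comp f (Fm_counit X).
Proof. by apply: chain_map_eq => j; apply: Fm_cm_out. Qed.

(** The witness is the degree-preserving part of a left inverse of [F f]; naturality of
[Fm_unit] turns its composite with [f] into that of the unrolled maps. *)
Lemma section_Fm_reflect (X Y : Cb A) (f : cat_hom X Y) :
  section (fun_hom (Fm A m) f) -> section f.
Proof.
move=> [r rf].
exists (chain_comp (Fm_counit X) (chain_comp (unroll_map r) (Fm_unit Y))).
have /= {rf}rf : chain_comp r (Fm_map m f) = chain_id _ := rf.
rewrite /= -!chain_assoc -Fm_unit_nat (chain_assoc (unroll_map r)).
by rewrite -unroll_map_comp rf unroll_map_id chain_idl Fm_unitK.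
Qed.

Lemma retraction_Fm_reflect (X Y : Cb A) (f : cat_hom X Y) :
  retraction (fun_hom (Fm A m) f) -> retraction f.
Proof.
move=> [r rf].
exists (chain_comp (Fm_counit X) (chain_comp (unroll_map r) (Fm_unit Y))).
have /= {rf}rf : chain_comp (Fm_map m f) r = chain_id _ := rf.
rewrite /= !chain_assoc -Fm_counit_nat -(chain_assoc _ _ (unroll_map r)).
by rewrite -unroll_map_comp rf unroll_map_id chain_idr Fm_unitK.
Qed.

Lemma section_functor (C D : category) (F : functor C D) (X Y : C) (f : cat_hom X Y) :
  section f -> section (fun_hom F f).
Proof. by move=> [r rf]; exists (fun_hom F r); rewrite -fun_comp rf fun_id. Qed.

Lemma retraction_functor (C D : category) (F : functor C D) (X Y : C) (f : cat_hom X Y) :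
  retraction f -> retraction (fun_hom F f).
Proof. by move=> [r rf]; exists (fun_hom F r); rewrite -fun_comp rf fun_id. Qed.

(** * Folding maps from or to an unrolled complex *)

Section Fold.
Variables (X : bcomplex A) (Z : Cper A m).

(** The components of [r] with target in the class of [i].  The entry of the identity
matrix of [Z] is the identity transported along the equality of the two residues. *)
Definition fold_to_cm (r : chain_map (unroll Z) X) (i : 'I_m) :
    hom (Z i) (Fm_complex m X i) :=
  col _ (fun t => r (idx i t) \oh
                  diag (fun i => idm (Z i)) i (residue (idx i t))).

Lemma Fm_out_fold (r : chain_map (unroll Z) X) j :
  Fm_out X (residue j) j \oh fold_to_cm r (residue j) = r j.
Proof.
rewrite (Fm_out_col (fun l => r l \oh diag (fun i => idm (Z i)) (residue j) (residue l))) //.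
by rewrite diag_eq comp_idr.
Qed.

Lemma fold_to_comm (r : chain_map (unroll Z) X) i i' :
  fold_to_cm r i' \oh cd Z i i' = cd (Fm_complex m X) i i' \oh fold_to_cm r i.
Proof.
have [e|ne] := eqVneq i' (ordS i); last by rewrite !cd_shape ?comp0l ?comp0r.
apply: Fm_out_ext => l li'.
(* Every degree has a predecessor; substituting it avoids casts of the form l - 1 + 1. *)
have [j lj] : exists j, l = j + 1 by exists (l - 1); rewrite subrK.
move: li'; rewrite {}lj => ji'.
have ji : residue j = i by apply: (@ordS_inj m); rewrite -residueS ji'.
rewrite -{}ji -{}ji' {e i i' l}.
rewrite !comp_assoc Fm_out_fold.
have outd := Fm_counit_comm X j; rewrite unroll_dS in outd.
rewrite [in RHS]outd -comp_assoc Fm_out_fold -(cm_comm r) unroll_dS //.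
Qed.

Definition fold_to (r : chain_map (unroll Z) X) : chain_map Z (Fm_complex m X) :=
  @ChainMap _ _ _ _ Z (Fm_complex m X) (fold_to_cm r) (fold_to_comm r).

Definition fold_from_cm (r : chain_map X (unroll Z)) (i : 'I_m) :
    hom (Fm_complex m X i) (Z i) :=
  row _ (fun t => diag (fun i => idm (Z i)) (residue (idx i t)) i \oh r (idx i t)).

Lemma fold_Fm_in (r : chain_map X (unroll Z)) j :
  fold_from_cm r (residue j) \oh Fm_in X (residue j) j = r j.
Proof.
rewrite (row_Fm_in (fun l => diag (fun i => idm (Z i)) (residue l) (residue j) \oh r l)) //.
by rewrite diag_eq comp_idl.
Qed.

Lemma fold_from_comm (r : chain_map X (unroll Z)) i i' :
  fold_from_cm r i' \oh cd (Fm_complex m X) i i' = cd Z i i' \oh fold_from_cm r i.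
Proof.
have [e|ne] := eqVneq i' (ordS i); last by rewrite !cd_shape ?comp0l ?comp0r.
apply: Fm_in_ext => j ji; move: e; rewrite -ji -residueS => ->.
rewrite -!comp_assoc fold_Fm_in.
have ind := Fm_unit_comm X j; rewrite unroll_dS in ind.
by rewrite -ind comp_assoc fold_Fm_in (cm_comm r) unroll_dS.
Qed.

Definition fold_from (r : chain_map X (unroll Z)) : chain_map (Fm_complex m X) Z :=
  @ChainMap _ _ _ _ (Fm_complex m X) Z (fold_from_cm r) (fold_from_comm r).

End Fold.

(** At most one nonzero object in each residue class modulo [m]. *)
Definition spread (X : cochain A) : Prop :=
  forall j l, residue j = residue l -> j != l -> is_zero (X j) \/ is_zero (X l).

(** The matrix of [fold_to r \o g] has the composites [X^j -> Z -> X^l] as entries.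
Those with [j = l] are identities by hypothesis; for [j != l] one end is a zero
object by [spread]. *)
Lemma fold_section (X : bcomplex A) (Z : Cper A m) (g : chain_map (Fm_complex m X) Z)
    (r : chain_map (unroll Z) X) : spread X ->
  chain_comp r (chain_comp (unroll_map g) (Fm_unit X)) = chain_id X ->
  chain_comp (fold_to r) g = chain_id (Fm_complex m X).
Proof.
move=> Xs rg; apply: chain_map_eq => i /=.
apply: Fm_out_ext => l <-; apply: Fm_in_ext => j jl.
rewrite comp_idr comp_assoc Fm_out_fold Fm_out_in //.
have [e|ne] := eqVneq j l; last first.
  by rewrite diag_neq //; case: (Xs _ _ jl ne) => [[X0 _]|[_ X0]]; apply: X0.
rewrite e diag_eq -comp_assoc.
exact: (congr1 (fun u : chain_map X X => u l) rg).
Qed.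

Lemma fold_retraction (Y : bcomplex A) (Z : Cper A m)
    (h : chain_map Z (Fm_complex m Y)) (r : chain_map Y (unroll Z)) : spread Y ->
  chain_comp (chain_comp (Fm_counit Y) (unroll_map h)) r = chain_id Y ->
  chain_comp h (fold_from r) = chain_id (Fm_complex m Y).
Proof.
move=> Ys hr; apply: chain_map_eq => i /=.
apply: Fm_in_ext => j <-; apply: Fm_out_ext => l lj.
rewrite comp_idl -comp_assoc fold_Fm_in Fm_out_in //.
have [e|ne] := eqVneq j l; last first.
  by rewrite diag_neq //; case: (Ys _ _ (esym lj) ne) => [[Y0 _]|[_ Y0]]; apply: Y0.
rewrite e diag_eq comp_assoc.
exact: (congr1 (fun u : chain_map Y Y => u l) hr).
Qed.

End Unroll.

(** A window of at most [m] consecutive degrees meets each residue class at most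
once. *)
Lemma csize_spread (k : comPzRingType) (A : additive_category k) (W : bcomplex A) m
    (m_gt0 : (0 < m)%N) : (csize W <= m)%N -> spread m_gt0 W.
Proof.
rewrite /csize; case: ex_minnP => n /asboolP[_ [t Wt]] _ nm j l jl ne.
have W0 (i : int) : ~~ (1 <= i - t <= n%:Z) -> is_zero (W i).
  by move=> /Wt /=; rewrite subrK.
have [jn|/W0] := boolP (1 <= j - t <= n%:Z); last by left.
have [ln|/W0] := boolP (1 <= l - t <= n%:Z); last by right.
case/eqP: ne; move: jn ln (idx_residue m_gt0 j) (idx_residue m_gt0 l); rewrite jl /idx.
move: (j %/ m%:Z)%Z (l %/ m%:Z)%Z (residue m_gt0 l) => p q i jn ln je le.
have pq : (p - q) * m%:Z < m%:Z by rewrite mulrBl; lia.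
have qp : (q - p) * m%:Z < m%:Z by rewrite mulrBl; lia.
suff pq0 : p = q by rewrite je le pq0.
nia.
Qed.

(** * The theorem *)

Theorem theorem2p9 (k : comPzRingType) (A : additive_category k)
    (X Y : Cb A) (f : cat_hom X Y) (m : nat) (hm : (csize (bdsum X Y) <= m)%N) :
  irreducible (fun_hom (Fm A m) f) <-> irreducible f.
Proof.
have m_gt0 : (0 < m)%N.
  by apply: leq_trans hm; rewrite /csize; case: ex_minnP => n /asboolP[].
have XYs : spread m_gt0 (bdsum X Y) by apply: csize_spread.
have Xs : spread m_gt0 X.
  by move=> j l jl /(XYs _ _ jl)[] /is_zero_bipl; [left|right].
have Ys : spread m_gt0 Y.
  by move=> j l jl /(XYs _ _ jl)[] /is_zero_bipr; [left|right].
split=> [[nsec nret irr]|irrf].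
  split=> [/(section_functor (Fm A m))//|/(retraction_functor (Fm A m))//|Z g h fhg].
  case: (irr _ (fun_hom (Fm A m) g) (fun_hom (Fm A m) h)).
  - by rewrite -fun_comp fhg.
  - by move/(section_Fm_reflect m_gt0); left.
  - by move/(retraction_Fm_reflect m_gt0); right.
split=> [/(section_Fm_reflect m_gt0)|/(retraction_Fm_reflect m_gt0)|Z g h fhg].
- by case: irrf.
- by case: irrf.
have fE : f = chain_comp (chain_comp (Fm_counit m_gt0 Y) (unroll_map m_gt0 h))
                (chain_comp (unroll_map m_gt0 g) (Fm_unit m_gt0 X)).
  rewrite -chain_assoc (chain_assoc (unroll_map m_gt0 h)) -unroll_map_comp.
  rewrite -[chain_comp h g]/(cat_comp h g) -fhg Fm_unit_nat chain_assoc.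
  by rewrite Fm_unitK chain_idl.
have [[r rg]|[r hr]] := irreducible_factor_cochain irrf fE.
  by left; exists (fold_to r); apply: fold_section Xs rg.
by right; exists (fold_from r); apply: fold_retraction Ys hr.
Qed.
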